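(* Let $S$ be a semigroup and let $\omega$ be a weight on $S$. Then $\ell^1(S,\omega)$ is a left (respectively, right) dual Banach algebra with predual $c_0(S,\omega)$ if and only if $\frac{1_{st^{-1}}}{\omega}\in c_0(S)$ (respectively, $\frac{1_{t^{-1}s}}{\omega}\in c_0(S)$) for all $s,t\in S$.
   Context: A weight on a semigroup $S$ is a function $\omega:S\to(0,\infty)$ with $\omega(st)\le\omega(s)\omega(t)$ for all $s,t\in S$. The weighted semigroup algebra $\ell^1(S,\omega)$ is the Banach algebra of all $f=\sum_{s\in S}f(s)\delta_s$ ($f:S\to\mathbb C$, $\delta_s$ the point mass at $s$) with $\|f\|_{1,\omega}=\sum_{s\in S}|f(s)|\omega(s)<\infty$, with product $f*g=\sum_{r\in S}\bigl(\sum_{st=r}f(s)g(t)\bigr)\delta_r$ (empty sums are $0$). Its dual is $\ell^\infty(S,\omega)=\{\phi:S\to\mathbb C:\ \|\phi\|_{\infty,\omega}=\sup_{s\in S}|\phi(s)/\omega(s)|<\infty\}$ via $\langle\phi,f\rangle=\sum_{s\in S}\phi(s)f(s)$. $c_0(S)$ is the space of functions on $S$ vanishing at infinity, where $S$ is discrete (for every $\epsilon>0$ the function has modulus $<\epsilon$ off a finite set). Put $c_0(S,\omega)=\{\phi\in\ell^\infty(S,\omega):\phi/\omega\in c_0(S)\}$; it is a closed subspace of $\ell^\infty(S,\omega)$ whose dual is $\ell^1(S,\omega)$ via the restricted pairing. For a Banach algebra $\mathfrak A$, the module actions on $\mathfrak A^*$ are $\langle f\cdot a,b\rangle=\langle f,ab\rangle$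 and $\langle a\cdot f,b\rangle=\langle f,ba\rangle$ ($a,b\in\mathfrak A$, $f\in\mathfrak A^*$). A Banach algebra $\mathfrak A$ that is a dual Banach space with predual $\mathfrak A_*$ (regarded as a closed subspace of $\mathfrak A^*$) is a left (respectively, right) dual Banach algebra with predual $\mathfrak A_*$ if $\mathfrak A_*$ is a left (respectively, right) $\mathfrak A$-submodule of $\mathfrak A^*$, i.e. $a\cdot f\in\mathfrak A_*$ (respectively, $f\cdot a\in\mathfrak A_*$) for all $a\in\mathfrak A$, $f\in\mathfrak A_*$. For $s,t\in S$: $t^{-1}s=\{r\in S: tr=s\}$ and $st^{-1}=\{r\in S: rt=s\}$. $1_F$ denotes the characteristic function of $F\subseteq S$. *)

(* Defs.v *)
From HB Require Import structures.
From mathcomp Require Import all_boot all_order all_algebra finmap complex.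
From mathcomp Require Import all_classical all_reals all_analysis.
From mathcomp Require Import showcase.summability.

Set Implicit Arguments.
Unset Strict Implicit.
Unset Printing Implicit Defensive.

Import Order.TTheory GRing.Theory Num.Theory.
Import numFieldNormedType.Exports.

Local Open Scope classical_set_scope.
Local Open Scope complex_scope.
Local Open Scope ring_scope.

Notation normc := ComplexField.Normc.normc.

Section dual_banach_algebra.
Variables (R : realType) (A : normedModType R[i]).
Local Notation C := (R[i]^o).
Implicit Types (mul : A -> A -> A) (f : A -> C) (P : set (A -> C)).

Record banach_algebra mul : Prop := BanachAlgebra {
  banach_complete : forall F : set_system A,
    ProperFilter F -> cauchy F -> cvg F;
  banach_mulA : associative mul;
  banach_mul_linearr : forall a, linear (mul a);
  banach_mul_linearl : forall b, linear (mul^~ b);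
  banach_mul_norm : forall a b, `|mul a b| <= `|a| * `|b|
}.

Definition dual : set (A -> C) := [set f : A -> C | linear f /\ continuous f].

Definition opnorm f : R :=
  sup [set normc (f a) | a in [set a : A | `|a| <= 1]].

Record closed_subspace P : Prop := ClosedSubspace {
  subspace_dual : P `<=` dual;
  subspace0 : P (cst 0);
  subspace_linear : forall (c : R[i]) f g, P f -> P g -> P (c *: f + g);
  subspace_closed : forall f, dual f ->
    (forall e : R, 0 < e -> exists2 g, P g & opnorm (f - g) < e) -> P f
}.

(* [L] represents an element of the dual of the normed space [P]; its values
   off [P] are irrelevant. *)
Definition bounded_functional_on P (L : (A -> C) -> C) :=
  (forall (c : R[i]) f g, P f -> P g -> L (c *: f + g) = c *: L f + L g) /\
  exists M : R, forall f, P f -> normc (L f) <= M * opnorm f.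

(* The evaluation map from [A] to the dual of [P] is an isometric
   isomorphism; injectivity follows from [predual_isometry]. *)
Record predual P : Prop := Predual {
  predual_closed : closed_subspace P;
  predual_isometry : forall a : A,
    `|a| = (sup [set normc (f a) | f in P `&` [set f | opnorm f <= 1]])%:C;
  predual_surjective : forall L, bounded_functional_on P L ->
    exists a : A, forall f, P f -> L f = f a
}.

(* [lact mul a f] is $a \cdot f$ and [ract mul f a] is $f \cdot a$. *)
Definition lact mul (a : A) f : A -> C := fun b => f (mul b a).
Definition ract mul f (a : A) : A -> C := fun b => f (mul a b).

Definition left_dual_banach_algebra mul P :=
  [/\ banach_algebra mul, predual P & forall a f, P f -> P (lact mul a f)].

Definition right_dual_banach_algebra mul P :=
  [/\ banach_algebra mul, predual P & forall a f, P f -> P (ract mul f a)].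

End dual_banach_algebra.

(* The unordered sum of [x] over [D]: the limit of the net of its sums over
   finite subsets, when it exists. *)
Definition csum (R : realType) (T : choiceType) (D : set T) (x : T -> R[i]^o) :
  R[i]^o := summability.sum (x \_ D).

Section csum_lemmas.
Variables (R : realType) (T : choiceType).
Implicit Types (D : set T) (x : T -> R[i]^o).

Lemma normc_sum (I : Type) (r : seq I) (Q : pred I) (F : I -> R[i]) :
  normc (\sum_(i <- r | Q i) F i) <= \sum_(i <- r | Q i) normc (F i).
Proof.
elim/big_ind2 : _ => //.
- by rewrite ComplexField.Normc.normc0.
- move=> a b c d ab cd; apply: le_trans (lerD ab cd).
  exact: le_normcD.
Qed.

Lemma normc_ge0 (z : R[i]) : 0 <= normc z.
Proof. by case: z => a b; exact: sqrtr_ge0. Qed.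

Lemma normrc (z : R[i]) : `|z| = (normc z)%:C.
Proof. by []. Qed.

Lemma normc_csum_le D x :
  ((normc (csum D x))%:E <= \esum_(i in D) (normc (x i))%:E)%E.
Proof.
rewrite /csum /summability.sum.
have [cvgS|dvgS] := pselect (cvg (partial_sum (x \_ D) @ totally)); last first.
  rewrite dvgP// [normc _](_ : _ = 0); last exact: ComplexField.Normc.normc0.
  by apply: esum_ge0 => i _; rewrite lee_fin normc_ge0.
apply/lee_addgt0Pr => e e0.
have e0C : 0 < e%:C :> R[i] by rewrite ltcR.
have totF : ProperFilter (@totally T) by exact: totally_filter.
have /filter_ex[/= F] := @cvgr_dist_lt _ _ _ _ (@filter_filter _ _ totF) _ _ cvgS _ e0C.
set l := lim _; move=> lF.
have {}lF : normc (l - partial_sum (x \_ D) F) <= e.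
  by rewrite -lecR -normrc; exact: ltW.
have -> : l = (l - partial_sum (x \_ D) F) + partial_sum (x \_ D) F.
  by rewrite subrK.
rewrite [leRHS]addeC.
apply: (@le_trans _ _ (e%:E + (normc (partial_sum (x \_ D) F))%:E)%E).
  rewrite -EFinD lee_fin (le_trans (le_normcD _ _))// lerD2r//.
rewrite leeD2l//.
rewrite esum_mkcond; apply: esum_ge; exists [set` F] => //.
rewrite fsbig_finite//= set_fsetK.
apply: (@le_trans _ _ (\sum_(i <- F) normc ((x \_ D) i))%:E).
  rewrite lee_fin /partial_sum.
  rewrite (le_trans (normc_sum _ _ _))//.
  by rewrite -(big_seq_fsetE _ _ predT (fun i => normc ((x \_ D) i))).
rewrite -sumEFin; apply: lee_sum => i _.
rewrite patchE; case: ifPn => // _.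
by rewrite ComplexField.Normc.normc0.
Qed.

Lemma ge0_esumZl D (c : R) (a : T -> \bar R) :
  0 <= c -> (forall i, (0 <= a i)%E) ->
  (\esum_(i in D) (c%:E * a i) = c%:E * \esum_(i in D) a i)%E.
Proof.
have esumZl_le (d : R) (b : T -> \bar R) : 0 <= d -> (forall i, (0 <= b i)%E) ->
    (\esum_(i in D) (d%:E * b i) <= d%:E * \esum_(i in D) b i)%E.
  move=> d0 b0; apply: ge_ereal_sup => _ [X [finX XD]] <-.
  rewrite -ge0_mule_fsumr// lee_pmul ?lee_fin//.
    by apply: fsume_ge0.
  by apply: ereal_sup_ubound; exists X.
rewrite le_eqVlt => /predU1P[<-|c0] a0.
  by rewrite mul0e esum1// => i _; rewrite mul0e.
apply/eqP; rewrite eq_le esumZl_le ?(ltW c0)//=.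
have ca0 i : (0 <= c%:E * a i)%E by rewrite mule_ge0// lee_fin ltW.
have cV0 : 0 <= c^-1 by rewrite invr_ge0 ltW.
rewrite -lee_pdivlMl// (le_trans _ (esumZl_le _ _ cV0 ca0))//.
by apply: le_esum => i _; rewrite muleA -EFinM mulVf ?gt_eqF// mul1e.
Qed.

End csum_lemmas.

(* Functions vanishing at infinity on the discrete space [T]. *)
Definition c0 (R : realType) (T : Type) : set (T -> R[i]) :=
  [set phi | forall e : R, 0 < e ->
    exists2 F : set T, finite_set F & forall s, ~ F s -> normc (phi s) < e].

Record weight (R : realType) (S : semigroupType) := Weight {
  weight_fun :> S -> R;
  weight_gt0 : forall s, 0 < weight_fun s;
  weight_submul : forall s t : S,
    weight_fun (s * t)%g <= weight_fun s * weight_fun t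
}.

Section weighted_l1.
Variables (R : realType) (S : semigroupType) (w : weight R S).
Local Notation C := (R[i]^o).
Implicit Types f g : S -> C.

Definition l1norm f : \bar R := \esum_(s in [set: S]) (normc (f s) * w s)%:E.

Definition l1_pred : {pred S -> C} := mem [set f | (l1norm f < +oo)%E].

Let term_ge0 f s : (0 <= (normc (f s) * w s)%:E)%E.
Proof. by rewrite lee_fin mulr_ge0 ?normc_ge0// ltW// weight_gt0. Qed.

Lemma l1norm_ge0 f : (0 <= l1norm f)%E.
Proof. by apply: esum_ge0 => s _. Qed.

Lemma l1norm_term f s : ((normc (f s) * w s)%:E <= l1norm f)%E.
Proof.
apply: esum_ge; exists [set s] => //.
by rewrite fsbig_set1.
Qed.

Lemma l1normD f g : (l1norm (f + g)%R <= l1norm f + l1norm g)%E.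
Proof.
rewrite /l1norm -esumD//; apply: le_esum => s _.
rewrite -EFinD lee_fin -mulrDl ler_wpM2r ?(ltW (weight_gt0 w _))//.
exact: le_normcD.
Qed.

Lemma l1norm0 : l1norm 0 = 0%E.
Proof.
by rewrite /l1norm esum1// => s _; rewrite ComplexField.Normc.normc0 mul0r.
Qed.

Lemma l1normZ (c : R[i]) f : l1norm (c *: f)%R = ((normc c)%:E * l1norm f)%E.
Proof.
rewrite /l1norm -ge0_esumZl ?normc_ge0//.
by apply: eq_esum => s _; rewrite -EFinM mulrA -ComplexField.Normc.normcM.
Qed.

Lemma l1_submod_closed : submod_closed l1_pred.
Proof.
split; first by rewrite inE/= l1norm0.
move=> c f g; rewrite !inE/= => foo goo.
apply: le_lt_trans (l1normD _ _) _.
apply: lte_add_pinfty => //; rewrite l1normZ.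
by apply: lte_mul_pinfty => //; rewrite lee_fin normc_ge0.
Qed.

HB.instance Definition _ :=
  GRing.isSubmodClosed.Build R[i] (S -> C) l1_pred l1_submod_closed.

Record l1 := L1 { l1_fun :> S -> C; l1_funP : l1_fun \in l1_pred }.

HB.instance Definition _ := [isSub for l1_fun].
HB.instance Definition _ := [Choice of l1 by <:].
HB.instance Definition _ := [SubChoice_isSubLmodule of l1 by <:].

Lemma l1_fin_num (f : l1) : l1norm f \is a fin_num.
Proof.
rewrite ge0_fin_numE ?l1norm_ge0//.
by have := l1_funP f; rewrite inE.
Qed.

Let norm (f : l1) : R[i] := (fine (l1norm f))%:C.

Let normD (f g : l1) : norm (f + g) <= norm f + norm g.
Proof.
rewrite /norm -rmorphD/= lecR -fineD ?l1_fin_num//.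
apply: fine_le; first exact: (l1_fin_num (f + g)).
  by rewrite fin_numD !l1_fin_num.
exact: (l1normD f g).
Qed.

Let normZ (c : R[i]) (f : l1) : norm (c *: f) = `|c| * norm f.
Proof.
by rewrite /norm normrc -rmorphM/= [l1norm _]l1normZ fineM// l1_fin_num.
Qed.

Let norm_eq0 (f : l1) : norm f = 0 -> f = 0.
Proof.
move=> /(congr1 (@complex.Re R))/= f0; apply/val_inj/funext => s /=.
apply: ComplexField.Normc.eq0_normc.
have := l1norm_term f s; rewrite -[l1norm f]fineK ?l1_fin_num// f0 lee_fin.
rewrite pmulr_lle0 ?weight_gt0// => n0.
by apply/eqP; rewrite eq_le n0 normc_ge0.
Qed.

HB.instance Definition _ :=
  Lmodule_isNormed.Build R[i] l1 normD normZ norm_eq0.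

Lemma l1_normE (f : l1) : `|f| = (fine (l1norm f))%:C.
Proof. by []. Qed.

(* $(f * g)(r) = \sum_{st = r} f(s) g(t)$ *)
Definition convolution_fun f g : S -> C := fun r =>
  csum [set p : S * S | (p.1 * p.2)%g = r] (fun p => f p.1 * g p.2).

Lemma l1norm_convolution f g : f \in l1_pred -> g \in l1_pred ->
  (l1norm (convolution_fun f g) <= l1norm f * l1norm g)%E.
Proof.
rewrite !inE/= => foo goo.
have goo' : l1norm g \is a fin_num by rewrite ge0_fin_numE// l1norm_ge0.
pose b s t := ((normc (f s) * w s) * (normc (g t) * w t))%:E.
have b0 s t : (0 <= b s t)%E.
  by rewrite /b EFinM mule_ge0//; exact: term_ge0.
have -> : (l1norm f * l1norm g =
    \esum_(s in [set: S]) \esum_(t in [set: S]) b s t)%E.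
  rewrite muleC -[l1norm g]fineK// -ge0_esumZl//; last first.
    by rewrite fine_ge0// l1norm_ge0.
  apply: eq_esum => s _; rewrite fineK// muleC -ge0_esumZl//.
  by rewrite -lee_fin; exact: term_ge0.
rewrite (esum_esum (J := fun=> [set: S]))//.
pose J r := [set p : S * S | (p.1 * p.2)%g = r].
apply: (@le_trans _ _ (\esum_(r in [set: S]) \esum_(p in J r) b p.1 p.2)%E).
  apply: le_esum => r _; rewrite EFinM muleC.
  apply: (@le_trans _ _ ((w r)%:E *
      \esum_(p in J r) (normc (f p.1 * g p.2))%:E)%E).
    rewrite lee_pmul2l ?lte_fin ?weight_gt0//.
    exact: (normc_csum_le _ (fun p => f p.1 * g p.2)).
  rewrite -ge0_esumZl; first last.
  - by move=> i; rewrite lee_fin normc_ge0.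
  - exact: ltW (weight_gt0 w r).
  apply: le_esum => -[s t] /= <-.
  rewrite -EFinM lee_fin ComplexField.Normc.normcM mulrACA [leRHS]mulrC.
  by rewrite ler_wpM2r ?mulr_ge0 ?normc_ge0// weight_submul.
rewrite esum_esum//.
rewrite (reindex_esum [set: S * S] _ (fun p => ((p.1 * p.2)%g, p)))//.
  by rewrite le_eqVlt; apply/orP; left; apply/eqP; congr (esum _ _); apply/seteqP.
split=> //.
- by move=> p q _ _ [].
- by move=> [r p] [/= _ <-]; exists p.
Qed.

Lemma convolution_in (f g : l1) : convolution_fun f g \in l1_pred.
Proof.
rewrite inE/=; apply: le_lt_trans (l1norm_convolution (l1_funP f) (l1_funP g)) _.
by rewrite -ge0_fin_numE ?mule_ge0 ?l1norm_ge0// fin_numM ?l1_fin_num.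
Qed.

Definition convolution (f g : l1) : l1 := L1 (convolution_in f g).

Definition linfty_weighted : set (S -> C) :=
  [set phi | exists M : R, forall s, normc (phi s / (w s)%:C) <= M].

Definition c0_weighted : set (S -> C) :=
  linfty_weighted `&` [set phi | c0 (fun s => phi s / (w s)%:C)].

Definition pairing (phi : S -> C) (f : l1) : C :=
  csum [set: S] (fun s => phi s * f s).

(* [c0_weighted] as a subspace of the dual of [l1]. *)
Definition c0_functionals : set (l1 -> C) :=
  [set pairing phi | phi in c0_weighted].

End weighted_l1.

(* [rquot s t] is $st^{-1}$ and [lquot t s] is $t^{-1}s$. *)
Definition rquot (S : semigroupType) (s t : S) : set S :=
  [set r | (r * t)%g = s].
Definition lquot (S : semigroupType) (t s : S) : set S :=
  [set r | (t * r)%g = s].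

(* Main.v *)
(* Bounded linear maps on l1(S, w) are determined by their values on the point
   masses delta s, which are dense.  Associativity of the convolution thus
   reduces to that of S, and every bounded functional f is the pairing with
   s |-> f (delta s), so that f belongs to c0(S, w) iff f (delta s) / w s
   vanishes at infinity.  Testing against finitely supported functions gives
   the duality of c0(S, w) and l1(S, w), and completeness of l1(S, w) follows
   since it is a dual space.  Then lact (delta t) sends the functional
   a |-> a s to the pairing with the indicator of s t^-1, which gives necessity;
   for sufficiency, the action of delta t on a functional f of c0(S, w) is
   small off the fibers s t^-1 over the finitely many s where f (delta s) / w s
   is not small, and the action of a general element follows by density. *)
Require Import Defs.
From HB Require Import structures.
From mathcomp Require Import all_boot all_order all_algebra finmap complex.
From mathcomp Require Import all_classical all_reals all_analysis.
From mathcomp Require Import showcase.summability.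

Set Implicit Arguments.
Unset Strict Implicit.
Unset Printing Implicit Defensive.

Import Order.TTheory GRing.Theory Num.Theory.
Import numFieldNormedType.Exports.

Local Open Scope classical_set_scope.
Local Open Scope complex_scope.
Local Open Scope ring_scope.

(** * Completeness of the complex numbers *)

Section complex_complete.
Variable R : realType.
Local Notation C := (R[i]^o).

Lemma normc_le_ReIm (z : R[i]) :
  normc z <= `|complex.Re z| + `|complex.Im z|.
Proof.
case: z => x y /=.
rewrite -(@ler_pXn2r _ 2)// ?nnegrE ?sqrtr_ge0 ?addr_ge0//.
rewrite sqr_sqrtr ?addr_ge0 ?sqr_ge0// sqrrD !real_normK ?num_real//.
by rewrite lerD2r lerDl mulrn_wge0// mulr_ge0.
Qed.

Lemma normc_ge_Im (z : R[i]) : `|complex.Im z| <= normc z.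
Proof.
case: z => x y /=; rewrite -sqrtr_sqr ler_wsqrtr// lerDr; exact: sqr_ge0.
Qed.

Lemma gt0_complexE (e : R[i]) : 0 < e -> e = (complex.Re e)%:C.
Proof. by case: e => x y; rewrite ltcE/= => /andP[/eqP->]. Qed.

Lemma gt0_Re (e : R[i]) : 0 < e -> 0 < complex.Re e.
Proof. by case: e => x y; rewrite ltcE/= => /andP[_]. Qed.

(** The real and imaginary parts are 1-Lipschitz, so they push [F] to Cauchy filters on [R], which
    converge; [normc_le_ReIm] then reassembles the two limits. *)
Lemma complex_cauchy_cvg (F : set_system C) :
  ProperFilter F -> cauchy F -> cvg F.
Proof.
move=> FF /cauchyP cauchyF.
have cvg_part (p : R[i] -> R) : {morph p : x y / x - y} ->
    (forall z, `|p z| <= normc z) -> cvg (p @ F).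
  move=> pB p_le; apply: cauchy_cvg; apply: cauchy_exP => e e0.
  have e0C : 0 < e%:C :> R[i] by rewrite ltcR.
  have [x Fx] := cauchyF _ e0C.
  exists (p x); apply: (@filterS _ F _ (ball x e%:C)) => // y.
  rewrite -!ball_normE/= -pB => xy.
  by rewrite (le_lt_trans (p_le _))// -ltcR.
have cvgRe : cvg (@complex.Re R @ F).
  apply: cvg_part => [[? ?] [? ?]//|z].
  by rewrite -lecR; exact: normc_ge_Re.
have cvgIm : cvg (@complex.Im R @ F).
  by apply: cvg_part => [[? ?] [? ?]//|z]; exact: normc_ge_Im.
apply/cvg_ex.
exists (lim (@complex.Re R @ F) +i* lim (@complex.Im R @ F)).
apply/cvgrPdist_lt => e e0; rewrite (gt0_complexE e0).
have e20 : 0 < complex.Re e / 2 by rewrite divr_gt0// gt0_Re.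
near=> z; rewrite normrc ltcR (le_lt_trans (normc_le_ReIm _))//.
rewrite [ltRHS]splitr ltrD//.
- have -> : complex.Re
      (lim (@complex.Re R @ F) +i* lim (@complex.Im R @ F) - z) =
    lim (@complex.Re R @ F) - complex.Re z by case: (z).
  by near: z; exact: cvgr_dist_lt cvgRe _ e20.
- have -> : complex.Im
      (lim (@complex.Re R @ F) +i* lim (@complex.Im R @ F) - z) =
    lim (@complex.Im R @ F) - complex.Im z by case: (z).
  by near: z; exact: cvgr_dist_lt cvgIm _ e20.
Unshelve. all: by end_near. Qed.

End complex_complete.

(** * Absolutely convergent unordered sums *)

Section csum_theory.
Variables (R : realType) (T : choiceType).
Local Notation C := (R[i]^o).
Implicit Types (D : set T) (x y : T -> C).

Definition csummable D x := (\esum_(i in D) (normc (x i))%:E < +oo)%E.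

(** A finite subset whose sum comes within [e] of the supremum leaves at most [e] for the rest of
    [D]. *)
Lemma esum_tail D (a : T -> \bar R) (e : R) : (forall i, (0 <= a i)%E) ->
  (\esum_(i in D) a i < +oo)%E -> 0 < e ->
  exists F : {fset T}, [set` F] `<=` D /\
    (\esum_(i in D `\` [set` F]) a i <= e%:E)%E.
Proof.
move=> a0 Doo e0.
have Dfin : \esum_(i in D) a i \is a fin_num.
  by rewrite ge0_fin_numE// esum_ge0.
have [_ [X [finX XD] <-]] := ub_ereal_sup_adherent e0 Dfin.
move: finX XD => /finite_fsetP[F ->] FD.
rewrite fsbig_finite//= set_fsetK => lte.
exists F; split => //.
have := @esumID R T [set` F] D a (fun i _ => a0 i).
rewrite (_ : D `&` [set` F] = [set` F]); last exact/setIidr.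
rewrite (esum_fset (finite_fset F))// fsbig_finite//= set_fsetK => DE.
have Ffin : \sum_(i <- F) a i \is a fin_num.
  rewrite ge0_fin_numE ?sume_ge0//; apply: le_lt_trans Doo.
  by rewrite DE leeDl// esum_ge0.
rewrite setDE -(@leeD2lE _ (\sum_(i <- F) a i)%E)// -DE.
by rewrite -leeBlDr//; exact: ltW.
Qed.

(** The net of partial sums is Cauchy: once [G] contains the set [F] of [esum_tail], the sums over
    [G] and [F] differ by a sum over [G] minus [F], which the tail bounds. *)
Lemma csum_cvg D x : csummable D x ->
  partial_sum (x \_ D) @ totally --> csum D x.
Proof.
move=> xoo.
have totF : ProperFilter (@totally T) by exact: totally_filter.
have imF : ProperFilter (partial_sum (x \_ D) @ totally).
  exact: fmap_proper_filter.
(* By definition [csum] is the [lim] of this net, so convergence to some limit suffices. *)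
suff : cvg (partial_sum (x \_ D) @ totally) by [].
apply: complex_cauchy_cvg => //; apply: cauchy_exP => e e0.
have n0 i : (0 <= (normc (x i))%:E)%E by rewrite lee_fin normc_ge0.
have e20 : 0 < complex.Re e / 2 by rewrite divr_gt0// gt0_Re.
have [F [FD Fe]] := esum_tail n0 xoo e20.
exists (partial_sum (x \_ D) F); exists F => // G /= FG.
rewrite -ball_normE/= distrC (gt0_complexE e0) normrc ltcR.
rewrite /partial_sum -!(big_seq_fsetE _ _ predT (x \_ D))/=.
have -> : \sum_(i <- G) (x \_ D) i - \sum_(i <- F) (x \_ D) i =
   \sum_(i <- [fset i | i in G & i \notin F]%fset) (x \_ D) i :> C.
  apply/eqP; rewrite subr_eq addrC; apply/eqP.
  rewrite (big_fsetID _ (mem F) G)/=; congr (_ + _); apply: eq_fbigl => i.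
  by rewrite !inE/= andb_idl// => /(fsubsetP FG).
rewrite (le_lt_trans (normc_sum _ _ _))//.
apply: (@le_lt_trans _ _ (complex.Re e / 2)); last first.
  by rewrite ltr_pdivrMr// ltr_pMr ?ltr1n// gt0_Re.
rewrite -lee_fin; apply: le_trans Fe.
rewrite esum_mkcond; apply: esum_ge.
exists [set` [fset i | i in G & i \notin F]%fset] => //.
rewrite fsbig_finite//= set_fsetK -sumEFin big_seq [leRHS]big_seq.
apply: lee_sum => i; rewrite !inE/= => /andP[_ iF].
rewrite patchE in_setD (@memNset _ [set` F]) ?andbT; last exact/negP.
by case: ifPn => //; rewrite ComplexField.Normc.normc0.
Qed.

Lemma csum_linear D (c : R[i]) x y : csummable D x -> csummable D y ->
  csum D (c *: x + y) = c *: csum D x + csum D y.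
Proof.
move=> xoo yoo; have totF : ProperFilter (@totally T) by exact: totally_filter.
apply: (@cvg_lim _ (@norm_hausdorff _ C)).
have -> : partial_sum ((c *: x + y) \_ D) =
    c *: partial_sum (x \_ D) + partial_sum (y \_ D) :> ({fset T} -> C).
  apply/funext => F; rewrite /partial_sum !fctE scaler_sumr -big_split/=.
  apply: eq_bigr => i _; rewrite !patchE; case: ifPn => // _.
  by rewrite scaler0 addr0.
by apply: cvgD; [apply: cvgZr|]; exact: csum_cvg.
Qed.

(** The partial sums are constant over the finite sets containing [j]; the value is 0 when [j] lies
    outside [D]. *)
Lemma csum_unique D x (j : T) : (forall i, i <> j -> D i -> x i = 0) ->
  csum D x = (x \_ D) j.
Proof.
move=> x0; have totF : ProperFilter (@totally T) by exact: totally_filter.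
apply: (@cvg_lim _ (@norm_hausdorff _ C)).
apply: cvg_near_cst.
exists [fset j]%fset => // F /= jF.
rewrite /partial_sum -(big_seq_fsetE _ _ predT (x \_ D))/=.
rewrite (big_fsetD1 j)/=; last by rewrite (fsubsetP jF)// inE.
rewrite big_seq big1 ?addr0// => i; rewrite !inE => /andP[/eqP ij _].
by rewrite patchE; case: ifPn => // /set_mem Di; exact: x0.
Qed.

End csum_theory.

(** * Bounded linear maps between complex normed spaces *)

Section continuous_linear.
Variable R : realType.
Implicit Types U V W : normedModType R[i].

(** With scalar target this unfolds to membership in [dual], so the facts below also apply to
    functionals. *)
Definition clinear V W (f : V -> W) := linear f /\ continuous f.

Lemma clinear_bound V W (f : V -> W) : clinear f ->
  exists2 M : R, 0 <= M & forall x, `|f x| <= M%:C * `|x|.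
Proof.
move=> [lf cf].
pose g : {linear V -> W} := HB.pack f (GRing.isLinear.Build _ _ _ _ f lf).
have /linear_boundedP/pinfty_ex_gt0[M M0 fM] :=
  continuous_linear_bounded 0 (cf 0 : {for 0, continuous g}).
exists (complex.Re M); first exact: ltW (gt0_Re M0).
by move=> x; rewrite -gt0_complexE//; exact: fM.
Qed.

Lemma bound_clinear V W (f : V -> W) (M : R) : linear f ->
  (forall x, `|f x| <= M%:C * `|x|) -> clinear f.
Proof.
move=> lf fM; split=> //.
pose g : {linear V -> W} := HB.pack f (GRing.isLinear.Build _ _ _ _ f lf).
apply: (@bounded_linear_continuous _ _ _ g); apply/linear_boundedP.
near=> r => x; rewrite (le_trans (fM x))// ler_wpM2r//.
near: r; apply: nbhs_pinfty_ge.
by rewrite realE (lecR 0 M) (lecR M 0); exact: num_real.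
Unshelve. all: by end_near. Qed.

Lemma clinear_comp U V W (f : U -> V) (g : V -> W) :
  clinear f -> clinear g -> clinear (g \o f).
Proof.
move=> [lf cf] [lg cg]; split=> [k x y|x]; first by rewrite /= lf lg.
by apply: continuous_comp; [exact: cf|exact: cg].
Qed.

Lemma clinear_sum V W (f : V -> W) (I : Type) (r : seq I) (c : I -> R[i])
  (g : I -> V) : clinear f ->
  f (\sum_(i <- r) c i *: g i) = \sum_(i <- r) c i *: f (g i).
Proof.
move=> [lf _].
pose h : {linear V -> W} := HB.pack f (GRing.isLinear.Build _ _ _ _ f lf).
have -> : f = h by [].
by rewrite linear_sum; apply: eq_bigr => i _; rewrite linearZ.
Qed.

Lemma clinear0 V W (f : V -> W) : clinear f -> f 0 = 0.
Proof.
move=> /(clinear_sum [::] (fun _ : nat => 0) (fun=> 0)).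
by rewrite !big_nil.
Qed.

Lemma clinearB V W (f : V -> W) x y : clinear f -> f (x - y) = f x - f y.
Proof.
by move=> [lf _]; rewrite addrC -scaleN1r lf scaleN1r addrC.
Qed.

Lemma clinear_linear V W (c : R[i]) (f g : V -> W) :
  clinear f -> clinear g -> clinear (fun x => c *: f x + g x).
Proof.
move=> [lf cf] [lg cg]; split=> [k x y|x].
  by rewrite lf lg !scalerDr !scalerA [c * k]mulrC addrACA.
have fx : f z @[z --> x] --> f x by exact: cf.
have gx : g z @[z --> x] --> g x by exact: cg.
by apply: cvgD gx; apply: cvgZ fx; exact: cvg_cst.
Qed.

End continuous_linear.

(** * Point masses and the convolution product on [l1] *)

Section weighted_l1_theory.
Variables (R : realType) (S : semigroupType) (w : weight R S).
Local Notation C := (R[i]^o).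
Local Notation l1 := (@l1 R S w).
Implicit Types (a b : l1) (s t : S).

Definition l1nrm a : R := fine (@l1norm R S w a).

Lemma normr_l1nrm a : `|a| = (l1nrm a)%:C.
Proof. by []. Qed.

Lemma l1nrm_ge0 a : 0 <= l1nrm a.
Proof. exact: fine_ge0 (l1norm_ge0 _ _). Qed.

Lemma l1nrmE a : (l1nrm a)%:E = @l1norm R S w a.
Proof. by rewrite fineK ?l1_fin_num. Qed.

Definition point (s : S) : S -> C := fun r => (r == s)%:R.

Lemma l1norm_point s : @l1norm R S w (point s) = (w s)%:E.
Proof.
rewrite /l1norm (esumID [set s]); last first.
  by move=> r _; rewrite lee_fin mulr_ge0 ?normc_ge0// ltW// weight_gt0.
rewrite setTI esum_set1; last first.
  by rewrite lee_fin mulr_ge0 ?normc_ge0// ltW// weight_gt0.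
rewrite /point eqxx ComplexField.Normc.normc1 mul1r.
rewrite esum1 ?adde0// => r [_ /= /eqP/negPf ->].
by rewrite ComplexField.Normc.normc0 mul0r.
Qed.

Lemma point_in s : point s \in @l1_pred R S w.
Proof. by rewrite inE/= l1norm_point ltry. Qed.

Definition delta s : l1 := L1 (point_in s).

Lemma l1nrm_delta s : l1nrm (delta s) = w s.
Proof. by rewrite /l1nrm l1norm_point. Qed.

Lemma l1_sumE (I : Type) (r : seq I) (g : I -> l1) (s : S) :
  (\sum_(i <- r) g i : l1) s = \sum_(i <- r) g i s.
Proof. by apply: (big_morph (fun a : l1 => a s)). Qed.

(** The approximant is the restriction of [a] to a finite set [F] outside which the norm series sums
    to at most [e]. *)
Lemma l1_approx a (e : R) : 0 < e ->
  exists F : {fset S}, l1nrm (a - \sum_(s <- F) a s *: delta s) <= e.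
Proof.
move=> e0.
have n0 s : (0 <= (normc (a s) * w s)%:E)%E.
  by rewrite lee_fin mulr_ge0 ?normc_ge0// ltW// weight_gt0.
have aoo : (\esum_(s in [set: S]) (normc (a s) * w s)%:E < +oo)%E.
  by have := l1_funP a; rewrite inE.
have [F [_ Fe]] := esum_tail n0 aoo e0.
exists F; rewrite -lee_fin l1nrmE; apply: le_trans Fe.
rewrite /l1norm [leRHS]esum_mkcond; apply: le_esum => s _.
have -> : (a - \sum_(t <- F) a t *: delta t : l1) s =
    a s - \sum_(t <- F) a t * (s == t)%:R.
  have -> : \sum_(t <- F) a t * (s == t)%:R =
      (\sum_(t <- F) a t *: delta t : l1) s by rewrite l1_sumE.
  by [].
have [sF|sF] := boolP (s \in F).
  rewrite (big_fsetD1 s)//= eqxx mulr1 big_seq big1 ?addr0; last first.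
    move=> t; rewrite !inE => /andP[+ _]; rewrite eq_sym => /negPf ->.
    by rewrite mulr0.
  by rewrite subrr ComplexField.Normc.normc0 mul0r; case: ifPn.
rewrite big_seq big1 ?subr0; last first.
  by move=> t tF; case: eqVneq sF => [->|_ _]; rewrite ?tF ?mulr0.
by rewrite mem_set//; split => //=; exact/negP.
Qed.

(** The maps agree on finite combinations [u] of point masses, hence
    [f a - g a = f (a - u) - g (a - u)], and [l1_approx] makes [a - u] arbitrarily small. *)
Lemma clinear_l1_ext (V : normedModType R[i]) (f g : l1 -> V) :
  clinear f -> clinear g -> (forall s, f (delta s) = g (delta s)) -> f =1 g.
Proof.
move=> cf cg fg a; apply/eqP; rewrite -subr_eq0 -normr_eq0.
have [M M0 fM] := clinear_bound cf; have [N N0 gN] := clinear_bound cg.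
suff fge (e : R) : 0 < e -> `|f a - g a| <= ((M + N) * e)%:C.
  rewrite eq_le normr_ge0 andbT.
  have nE : `|f a - g a| = (complex.Re `|f a - g a|)%:C.
    have := fge 1 ltr01; case: `|f a - g a| => x y.
    by rewrite lecE/= => /andP[/eqP <-].
  rewrite nE lecR; apply/ler_addgt0Pr => e e0; rewrite add0r -lecR -nE.
  (* The added 1 keeps the divisor positive when [M = N = 0]. *)
  have MN0 : 0 < M + N + 1 by rewrite ltr_wpDl// addr_ge0.
  rewrite (le_trans (fge (e / (M + N + 1)) _)) ?divr_gt0// lecR.
  by rewrite mulrCA ger_pMr// ler_pdivrMr// mul1r lerDl.
move=> e0; have [F Fe] := l1_approx a e0.
set u := \sum_(s <- F) _ in Fe.
have fgu : f u = g u.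
  by rewrite !clinear_sum//; apply: eq_bigr => s _; rewrite fg.
have -> : f a - g a = f (a - u) - g (a - u).
  by rewrite (clinearB _ _ cf) (clinearB _ _ cg) fgu opprB addrA subrK.
rewrite (le_trans (ler_normB _ _))// (le_trans (lerD (fM _) (gN _)))//.
rewrite -mulrDl normr_l1nrm -rmorphD -rmorphM lecR ler_wpM2l// addr_ge0//.
Qed.

Local Notation conv := (@convolution R S w).
Local Notation fiber r := [set p : S * S | (p.1 * p.2)%g = r].

(** On the fiber over [r] one has [w r <= w p.1 * w p.2], so [w r] times the sum is at most the
    product of the two norms. *)
Lemma csummable_convolution a b r :
  csummable (fiber r) (fun p => a p.1 * b p.2).
Proof.
have t0 c s : (0 <= (normc (c s) * w s)%:E :> \bar R)%E.
  by rewrite lee_fin mulr_ge0 ?normc_ge0// ltW// weight_gt0.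
have ab_fin : (@l1norm R S w a * @l1norm R S w b < +oo)%E.
  by rewrite -ge0_fin_numE ?mule_ge0 ?l1norm_ge0// fin_numM ?l1_fin_num.
pose c s t := ((normc (a s) * w s)%:E * (normc (b t) * w t)%:E)%E.
have c0 s t : (0 <= c s t)%E by rewrite mule_ge0.
have abE : (@l1norm R S w a * @l1norm R S w b =
    \esum_(p in [set: S * S]) c p.1 p.2)%E.
  have -> : [set: S * S] = [set: S] `*`` (fun=> [set: S]) by exact/seteqP.
  rewrite -(esum_esum (J := fun=> [set: S]))// muleC -l1nrmE -ge0_esumZl//.
    by apply: eq_esum => s _; rewrite l1nrmE muleC -ge0_esumZl// -lee_fin.
  exact: l1nrm_ge0.
have wr0 := weight_gt0 w r.
suff wle : ((w r)%:E * (\esum_(p in fiber r) (normc (a p.1 * b p.2))%:E) <=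
    @l1norm R S w a * @l1norm R S w b)%E.
  have /(le_lt_trans wle) := ab_fin.
  rewrite /csummable !ltey; apply: contra => /eqP ->.
  by rewrite gt0_muley ?lte_fin.
rewrite -ge0_esumZl; first last.
- by move=> i; rewrite lee_fin normc_ge0.
- exact: ltW.
rewrite abE esum_mkcond; apply: le_esum => -[s t] _ /=.
case: ifPn => // /set_mem /= <-.
rewrite /c -!EFinM lee_fin ComplexField.Normc.normcM mulrACA [leRHS]mulrC.
rewrite mulrC [leLHS]mulrC.
by rewrite ler_wpM2l ?mulr_ge0 ?normc_ge0// weight_submul.
Qed.

Lemma l1nrm_convolution a b : l1nrm (conv a b) <= l1nrm a * l1nrm b.
Proof.
rewrite -lee_fin EFinM !l1nrmE.
exact: l1norm_convolution (l1_funP a) (l1_funP b).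
Qed.

Lemma norm_convolution a b : `|conv a b| <= `|a| * `|b|.
Proof. by rewrite !normr_l1nrm -rmorphM lecR l1nrm_convolution. Qed.

Lemma convolution_linearr a : linear (conv a).
Proof.
move=> k b c; apply/val_inj/funext => r.
apply: etrans (csum_linear k (csummable_convolution a b r)
                            (csummable_convolution a c r)).
by rewrite /=; congr csum; apply/funext => p; rewrite !fctE/= mulrDr mulrCA.
Qed.

Lemma convolution_linearl b : linear (conv^~ b).
Proof.
move=> k a c; apply/val_inj/funext => r.
apply: etrans (csum_linear k (csummable_convolution a b r)
                            (csummable_convolution c b r)).
by rewrite /=; congr csum; apply/funext => p; rewrite !fctE/= mulrDl -mulrA.
Qed.

Lemma clinear_convr a : clinear (conv a).
Proof.
apply: (bound_clinear (M := l1nrm a) (convolution_linearr a)) => b.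
exact: norm_convolution.
Qed.

Lemma clinear_convl b : clinear (conv^~ b).
Proof.
apply: (bound_clinear (M := l1nrm b) (convolution_linearl b)) => a.
by rewrite mulrC; exact: norm_convolution.
Qed.

Lemma convolution_delta s t : conv (delta s) (delta t) = delta (s * t)%g.
Proof.
apply/val_inj/funext => r /=.
(* Only the pair [(s, t)] can contribute; its patched value is 0 unless the pair lies in the fiber
   over [r]. *)
rewrite /convolution_fun (@csum_unique _ _ _ _ (s, t)).
  rewrite patchE /point/= !eqxx mulr1; case: ifPn => [/set_mem/= <-|].
    by rewrite eqxx.
  by case: eqVneq => // ->; rewrite notin_setE /= => /(_ erefl).
move=> [p q] /= pq _; rewrite /point.
case: eqVneq => [ps|]; last by rewrite mul0r.
case: eqVneq => [qt|]; last by rewrite mulr0.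
by case: pq; rewrite ps qt.
Qed.

(** [clinear_l1_ext] is applied in one variable at a time: [c], then [b], then [a] becomes a point
    mass, and the remaining identity is [mulgA]. *)
Lemma convolutionA : associative conv.
Proof.
move=> a b c; apply: (@clinear_l1_ext _ (fun c => conv a (conv b c))
  (conv (conv a b))).
- exact: clinear_comp (clinear_convr b) (clinear_convr a).
- exact: clinear_convr.
move=> {c} t; apply: (@clinear_l1_ext _ (fun b => conv a (conv b (delta t)))
  (fun b => conv (conv a b) (delta t))).
- exact: clinear_comp (clinear_convl _) (clinear_convr a).
- exact: clinear_comp (clinear_convr a) (clinear_convl _).
move=> {b} s; apply: (@clinear_l1_ext _
  (fun a => conv a (conv (delta s) (delta t)))
  (fun a => conv (conv a (delta s)) (delta t))).
- exact: clinear_convl.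
- exact: clinear_comp (clinear_convl _) (clinear_convl _).
by move=> r; rewrite !convolution_delta mulgA.
Qed.

End weighted_l1_theory.

(** * The operator norm, and completeness of a space with a predual *)

Section dual_norm.
Variables (R : realType) (A : normedModType R[i]).
Local Notation C := (R[i]^o).
Implicit Types (f : A -> C) (P : set (A -> C)).

Lemma norm_ReE (a : A) : `|a| = (complex.Re `|a|)%:C.
Proof.
by have := normr_ge0 a; case: `|a| => x y; rewrite lecE/= => /andP[/eqP ->].
Qed.

Lemma Re_norm_ge0 (a : A) : 0 <= complex.Re `|a|.
Proof. by have := normr_ge0 a; rewrite lecE => /andP[]. Qed.

Lemma opnorm_le f (M : R) :
  (forall a, `|a| <= 1 -> normc (f a) <= M) -> opnorm f <= M.
Proof.
move=> fM; apply: ge_sup; last by move=> _ [a a1 <-]; exact: fM.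
by exists (normc (f 0)); exists 0 => //=; rewrite normr0.
Qed.

Lemma opnorm_ub f a : dual f -> `|a| <= 1 -> normc (f a) <= opnorm f.
Proof.
move=> df a1; apply: ub_le_sup; last by exists a.
have [M M0 fM] := clinear_bound df.
exists M => _ [b /= b1 <-]; rewrite -lecR -normrc (le_trans (fM b))//.
by rewrite ler_piMr// lecR.
Qed.

Lemma opnorm_ge0 f : dual f -> 0 <= opnorm f.
Proof.
move=> df; apply: le_trans (normc_ge0 (f 0)) _.
by apply: opnorm_ub => //; rewrite normr0.
Qed.

Lemma normc_dual f a : dual f -> normc (f a) <= opnorm f * complex.Re `|a|.
Proof.
move=> df; have [->|a0] := eqVneq a 0.
  by rewrite normr0 mulr0 (clinear0 df) ComplexField.Normc.normc0.
have na0 : 0 < complex.Re `|a| by rewrite gt0_Re// normr_gt0.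
rewrite -ler_pdivrMr//.
have <- : normc (f (`|a|^-1 *: a)) = normc (f a) / complex.Re `|a|.
  (* A one-term instance of [clinear_sum] serves as homogeneity of [f]. *)
  have := @clinear_sum _ _ _ f nat [:: 0%N] (fun=> `|a|^-1) (fun=> a) df.
  rewrite !big_seq1 => ->.
  rewrite ComplexField.Normc.normcM mulrC; congr (_ * _).
  apply: complexI; rewrite -normrc normfV normr_id {1}norm_ReE.
  by rewrite fmorphV.
by apply: opnorm_ub => //; rewrite normrZ normfV normr_id mulVf// normr_eq0.
Qed.

Lemma lim_dist_le (T : Type) (F : set_system T) (f : T -> C) (l y : C) (M : R) :
  ProperFilter F -> f @ F --> l -> F [set x | normc (f x - y) <= M] ->
  normc (l - y) <= M.
Proof.
move=> FF fl Fy; apply/ler_addgt0Pr => e e0.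
have e0C : 0 < e%:C :> R[i] by rewrite ltcR.
have /cvgrPdist_lt/(_ _ e0C) lF := fl.
have [x [/= xy lx]] : exists x, normc (f x - y) <= M /\ `|l - f x| < e%:C.
  exact: filter_ex (@filterI _ F _ _ _ Fy lF).
have -> : l - y = (f x - y) + (l - f x) by rewrite [RHS]addrC addrA subrK.
rewrite (le_trans (le_normcD _ _))// lerD// -lecR; exact: ltW.
Qed.

(** Along a Cauchy filter [F] each [f] in [P] has a limit [L f], and [L] is a bounded functional on
    [P]. Surjectivity represents [L] by some [a], and the isometry turns a uniform estimate of
    [f a - f y] over the unit ball of [P] into convergence of [F] to [a]. *)
Lemma predual_complete P : predual P ->
  forall F : set_system A, ProperFilter F -> cauchy F -> cvg F.
Proof.
move=> [[Pdual P0 _ _] isoP surjP] F FF /cauchyP cauchyF.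
have cauchyFe (e : R) : 0 < e ->
    exists x, F [set y | complex.Re `|x - y| < e].
  move=> e0; have e0C : 0 < e%:C :> R[i] by rewrite ltcR.
  have [x Fx] := cauchyF _ e0C; exists x; apply: filterS Fx => y.
  by rewrite -ball_normE/= norm_ReE ltcR.
have ReB (x y z : A) :
    complex.Re `|x - y| <= complex.Re `|z - x| + complex.Re `|z - y|.
  rewrite -lecR rmorphD/= -!norm_ReE -(distrC x z).
  by rewrite -{1}(subrK z x) -addrA ler_normD.
pose L f : C := lim (f @ F).
have LP f : P f -> f @ F --> L f.
  move=> /Pdual df; apply: complex_cauchy_cvg.
  apply: cauchy_exP => e e0.
  have f0 : 0 < opnorm f + 1 by rewrite ltr_wpDl// opnorm_ge0.
  have [x Fx] := cauchyFe (complex.Re e / (opnorm f + 1))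
    (divr_gt0 (gt0_Re e0) f0).
  exists (f x).
  apply: (@filterS _ F _ _ (f @^-1` ball (f x) e) _ Fx) => y /= xy.
  rewrite -ball_normE/= -clinearB// (gt0_complexE e0) normrc ltcR.
  rewrite (le_lt_trans (normc_dual _ df))//.
  rewrite ltr_pdivlMr// mulrC in xy; apply: le_lt_trans xy.
  by rewrite ler_wpM2r ?lerDl ?Re_norm_ge0.
have Lbounded : bounded_functional_on P L.
  split=> [c f g Pf Pg|].
    apply: (@cvg_lim _ (@norm_hausdorff _ C)).
    by apply: cvgD; [apply: cvgZr|]; exact: LP.
  (* Eventually along [F] the norm is at most [|x| + 1], which bounds [L]. *)
  have [x Fx] := cauchyFe 1 ltr01.
  exists (complex.Re `|x| + 1) => f Pf; have df := Pdual _ Pf.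
  rewrite -[L f]subr0; apply: (lim_dist_le _ (LP f Pf)).
  apply: filterS Fx => y /= xy; rewrite subr0 (le_trans (normc_dual _ df))//.
  rewrite mulrC ler_wpM2r ?opnorm_ge0//.
  have := ReB y 0 x; rewrite !subr0 => /le_trans; apply.
  by rewrite addrC lerD2l ltW.
have [a La] := surjP L Lbounded.
apply/cvg_ex; exists a; apply/cvgrPdist_le => e e0.
have e20 : 0 < complex.Re e / 2 by rewrite divr_gt0// gt0_Re.
have [x Fx] := cauchyFe _ e20.
apply: filterS (Fx) => y /= xy; rewrite (gt0_complexE e0) isoP lecR.
pose f0 : A -> C := cst 0.
have f0P : (P `&` [set f | opnorm f <= 1]) f0.
  split=> //=; apply: (le_trans _ ler01); apply: opnorm_le => b _.
  by rewrite ComplexField.Normc.normc0.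
apply: ge_sup.
  by exists (normc (f0 (a - y))); exists f0.
move=> _ [f /= [Pf f1] <-]; have df := Pdual _ Pf.
(* [f a] is the limit of [f z] along [F], and eventually [z], like [y], is within [e / 2] of [x]. *)
rewrite (clinearB _ _ df) -La//; apply: (lim_dist_le _ (LP f Pf)).
apply: filterS Fx => z /= xz; rewrite -(clinearB _ _ df).
rewrite (le_trans (normc_dual _ df))//.
apply: (@le_trans _ _ (complex.Re `|z - y|)).
  by rewrite ler_piMl ?Re_norm_ge0.
rewrite (le_trans (ReB _ _ x))// [leRHS]splitr lerD// ltW//.
Qed.

End dual_norm.

(** * Functions vanishing at infinity *)

Section vanishing_functions.
Variables (R : realType) (T : choiceType).
Implicit Types (f g : T -> R[i]).

Lemma c0P f : c0 f <->
  forall e : R, 0 < e -> finite_set [set s | e <= normc (f s)].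
Proof.
split=> [f0 e e0|f0 e e0].
  have [F finF Fe] := f0 e e0; apply: sub_finite_set finF => s /= es.
  by apply: contrapT => /Fe; rewrite ltNge es.
exists [set s | e <= normc (f s)]; first exact: f0.
by move=> s /negP; rewrite -ltNge.
Qed.

Lemma finite_c0 (X : set T) f : finite_set X ->
  (forall s, ~ X s -> f s = 0) -> c0 f.
Proof.
move=> finX f0 e e0; exists X => // s /f0 ->.
by rewrite ComplexField.Normc.normc0.
Qed.

Lemma c0_approx f :
  (forall e : R, 0 < e -> exists2 g, c0 g & forall s, normc (f s - g s) <= e) ->
  c0 f.
Proof.
move=> fg e e0; have e20 : 0 < e / 2 by rewrite divr_gt0.
have [g g0 gle] := fg _ e20; have [F finF Fe] := g0 _ e20.
exists F => // s /Fe gs; rewrite -(subrK (g s) (f s)).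
by rewrite (le_lt_trans (le_normcD _ _))// [ltRHS]splitr ler_ltD.
Qed.

Lemma c0_linear (c : R[i]) f g : c0 f -> c0 g ->
  c0 (fun s => c * f s + g s).
Proof.
move=> f0 g0 e e0.
have c1 : 0 < normc c + 1 by rewrite ltr_wpDl ?normc_ge0.
have e20 : 0 < e / 2 by rewrite divr_gt0.
have ec0 : 0 < e / 2 / (normc c + 1) by rewrite divr_gt0.
have [F finF Fe] := f0 _ ec0; have [G finG Ge] := g0 _ e20.
exists (F `|` G); first by rewrite finite_setU.
move=> s /not_orP[/Fe fs /Ge gs].
rewrite (le_lt_trans (le_normcD _ _))// [ltRHS]splitr ler_ltD//.
rewrite ComplexField.Normc.normcM.
rewrite ltr_pdivlMr// mulrC in fs; apply: le_trans (ltW fs).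
by rewrite ler_wpM2r ?normc_ge0// lerDl.
Qed.

Lemma c0_sum (I : Type) (r : seq I) (c : I -> R[i]) (f : I -> T -> R[i]) :
  (forall i, c0 (f i)) -> c0 (fun s => \sum_(i <- r) c i * f i s).
Proof.
move=> f0; elim: r => [|i r IHr].
  by apply: (@finite_c0 set0) => // s _; rewrite big_nil.
have /= := c0_linear (c i) (f0 i) IHr.
by congr c0; apply/funext => s; rewrite big_cons.
Qed.

End vanishing_functions.

(** * The duality between c0(S, w) and l1(S, w) *)

Section predual_of_l1.
Variables (R : realType) (S : semigroupType) (w : weight R S).
Local Notation C := (R[i]^o).
Local Notation l1 := (@l1 R S w).
Local Notation P := (@c0_functionals R S w).
Implicit Types (a b : l1) (s t : S) (f g : l1 -> C).

Lemma normc_divw (z : R[i]) s : normc (z / (w s)%:C) = normc z / w s.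
Proof.
rewrite ComplexField.Normc.normcM ComplexField.Normc.normcV; congr (_ / _).
by apply: complexI; rewrite -normrc gtr0_norm// ltcR weight_gt0.
Qed.

Lemma Re_norm_l1 a : complex.Re `|a| = l1nrm a.
Proof. by []. Qed.

Lemma pairing_term_le phi (M : R) a :
  (forall s, normc (phi s) <= M * w s) -> 0 <= M ->
  (\esum_(s in [set: S]) (normc (phi s * a s))%:E <= (M * l1nrm a)%:E)%E.
Proof.
move=> phiM M0; rewrite EFinM l1nrmE -ge0_esumZl//; last first.
  by move=> s; rewrite lee_fin mulr_ge0 ?normc_ge0// ltW// weight_gt0.
apply: le_esum => s _; rewrite -EFinM lee_fin ComplexField.Normc.normcM.
by rewrite [_ * w s]mulrC mulrA ler_wpM2r ?normc_ge0.
Qed.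

Lemma normc_pairing_le phi (M : R) a :
  (forall s, normc (phi s) <= M * w s) -> 0 <= M ->
  normc (pairing phi a) <= M * l1nrm a.
Proof.
move=> phiM M0; rewrite -lee_fin; apply: le_trans (pairing_term_le a phiM M0).
exact: (normc_csum_le _ (fun s => phi s * a s)).
Qed.

Lemma clinear_pairing phi (M : R) :
  (forall s, normc (phi s) <= M * w s) -> 0 <= M ->
  clinear (@pairing R S w phi).
Proof.
move=> phiM M0; apply: (bound_clinear (M := M)) => [c a b|a]; last first.
  by rewrite normr_l1nrm normrc -rmorphM lecR; exact: normc_pairing_le.
have sum_ a' : csummable [set: S] (fun s => phi s * a' s).
  by apply: le_lt_trans (pairing_term_le a' phiM M0) _; rewrite ltry.
apply: etrans (csum_linear c (sum_ a) (sum_ b)).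
rewrite /pairing; congr csum.
by apply/funext => s; rewrite !fctE/= mulrDr mulrCA.
Qed.

Lemma pairing_delta phi s : pairing phi (delta w s) = phi s.
Proof.
rewrite /pairing (@csum_unique _ _ _ _ s); last first.
  by move=> t /eqP/negPf ts _; rewrite /delta/= /point ts mulr0.
by rewrite patchE in_setT /= /point eqxx mulr1.
Qed.

Lemma normc_dual_delta f s : dual f -> normc (f (delta w s)) <= opnorm f * w s.
Proof.
by move=> df; rewrite (le_trans (normc_dual _ df))// Re_norm_l1 l1nrm_delta.
Qed.

Lemma dual_pairing f : dual f -> f = pairing (fun s => f (delta w s)).
Proof.
move=> df; apply/funext; apply: (clinear_l1_ext df).
  apply: (@clinear_pairing _ (opnorm f)); last exact: opnorm_ge0.
  by move=> s; exact: normc_dual_delta.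
by move=> s; rewrite pairing_delta.
Qed.

(** Together with [normc_dual_delta], this identifies the operator norm of [f] with the weighted
    supremum norm of [s |-> f (delta s)]. *)
Lemma opnorm_le_delta f (M : R) : dual f -> 0 <= M ->
  (forall s, normc (f (delta w s)) <= M * w s) -> opnorm f <= M.
Proof.
move=> df M0 fM; apply: opnorm_le => a; rewrite normr_l1nrm lecR => a1.
rewrite (dual_pairing df) (le_trans (normc_pairing_le _ fM M0))//.
by rewrite ler_piMr.
Qed.

(** The function [phi] is recovered as the values of the functional at the point masses, which turns
    the existential into a condition on [f] itself. *)
Lemma c0_functionalsP f :
  P f <-> dual f /\ c0 (fun s => f (delta w s) / (w s)%:C).
Proof.
split=> [[phi [[M phiM] phi0] <-]|[df f0]].
  (* The maximum with 0 supplies the nonnegative constant that [clinear_pairing] asks for. *)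
  have phiM' s : normc (phi s) <= Num.max M 0 * w s.
    rewrite -ler_pdivrMr ?weight_gt0// -normc_divw le_max.
    by rewrite (phiM s).
  split; first by apply: clinear_pairing phiM' _; rewrite le_max lexx orbT.
  by under eq_fun do rewrite pairing_delta.
exists (fun s => f (delta w s)); last exact/esym/dual_pairing.
split => //; exists (opnorm f) => s.
by rewrite normc_divw ler_pdivrMr ?weight_gt0// normc_dual_delta.
Qed.

Lemma dual_linear (c : R[i]) f g : dual f -> dual g -> dual (c *: f + g).
Proof. exact: clinear_linear. Qed.

(** For closedness: [delta s] has norm [w s], so closeness in [opnorm] gives uniform closeness of
    the quotients [f (delta s) / w s], and [c0_approx] applies. *)
Lemma c0_functionals_closed : closed_subspace P.
Proof.
have P0 : P (cst 0).
  apply/c0_functionalsP; split.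
    by split=> [k a b|]; [rewrite /= scaler0 addr0|exact: cst_continuous].
  by apply: (@finite_c0 _ _ set0) => // s _; rewrite mul0r.
have Plin (c : R[i]) f g : P f -> P g -> P (c *: f + g).
  move=> /c0_functionalsP[df f0] /c0_functionalsP[dg g0].
  apply/c0_functionalsP; split; first exact: dual_linear.
  have /= := c0_linear c f0 g0; congr c0; apply/funext => s.
  by rewrite !fctE mulrA -mulrDl.
split=> // [f /c0_functionalsP[]//|f df fP].
apply/c0_functionalsP; split=> //; apply: c0_approx => e e0.
have [g Pg fg] := fP e e0; have /c0_functionalsP[dg g0] := Pg.
exists (fun s => g (delta w s) / (w s)%:C) => // s.
rewrite -mulrBl normc_divw ler_pdivrMr ?weight_gt0//.
have dfg : dual (f - g).
  by rewrite addrC -scaleN1r; exact: dual_linear.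
rewrite (le_trans (normc_dual_delta s dfg))// ler_wpM2r ?ltW ?weight_gt0//.
Qed.

(** The element of c0(S, w) given by the characteristic function of [{s}]; these span the finitely
    supported functionals. *)
Definition coord s : l1 -> C := fun a => a s.

Lemma coord_dual s : dual (coord s).
Proof.
apply: (bound_clinear (M := (w s)^-1)) => // a.
rewrite normr_l1nrm normrc -rmorphM lecR ler_pdivlMl ?weight_gt0// mulrC.
by rewrite -lee_fin l1nrmE; exact: l1norm_term.
Qed.

Lemma c0_functionals_coord s : P (coord s).
Proof.
apply/c0_functionalsP; split; first exact: coord_dual.
apply: (@finite_c0 _ _ [set s]) => // t /eqP ts.
by rewrite /coord/= /point eq_sym (negPf ts) mul0r.
Qed.

(** [L] is linear only on [P], so membership in [P] is carried through the same induction as the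
    formula. *)
Lemma bounded_functional_sum (L : (l1 -> C) -> C) (I : Type) (r : seq I)
    (c : I -> R[i]) (g : I -> l1 -> C) :
  bounded_functional_on P L -> (forall i, P (g i)) ->
  P (\sum_(i <- r) c i *: g i) /\
  L (\sum_(i <- r) c i *: g i) = \sum_(i <- r) c i *: L (g i).
Proof.
move=> [Llin [M LM]] Pg; have [_ P0 Plin _] := c0_functionals_closed.
elim: r => [|i r [Pr Lr]]; last first.
  by rewrite !big_cons; split; [exact: Plin|rewrite Llin// Lr].
rewrite !big_nil; split=> //.
have := Llin (-1) _ _ P0 P0.
by rewrite !scaleN1r !addNr.
Qed.

Lemma c0_functionals_sum (F : seq S) (c : S -> R[i]) :
  P (\sum_(s <- F) c s *: coord s).
Proof.
have L0 : bounded_functional_on P (fun=> 0).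
  split=> [*|]; first by rewrite scaler0 addr0.
  by exists 0 => f _; rewrite ComplexField.Normc.normc0 mul0r.
by have [] := bounded_functional_sum F c L0 c0_functionals_coord.
Qed.

Lemma coord_sumE (F : seq S) (c : S -> R[i]) a :
  (\sum_(s <- F) c s *: coord s) a = \sum_(s <- F) c s * a s.
Proof. by rewrite fct_sumE. Qed.

Lemma coord_sum_delta (F : {fset S}) (c : S -> R[i]) t :
  (\sum_(s <- F) c s *: coord s) (delta w t) = if t \in F then c t else 0.
Proof.
rewrite coord_sumE; case: ifPn => tF.
  rewrite (big_fsetD1 t)//= /point eqxx mulr1 big_seq big1 ?addr0// => s.
  by rewrite !inE => /andP[/negPf -> _]; rewrite mulr0.
rewrite big_seq big1// => s sF; rewrite /= /point.
by case: eqVneq tF => [<-|_ _]; rewrite ?sF ?mulr0.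
Qed.

(* [phase 0 = 0], since [0 / 0 = 0]. *)
Definition phase (z : R[i]) : R[i] := `|z| / z.

Lemma phaseM z : phase z * z = (normc z)%:C.
Proof.
rewrite /phase; have [->|z0] := eqVneq z 0; last by rewrite divfK.
by rewrite mulr0 ComplexField.Normc.normc0.
Qed.

Lemma normc_phase_le z : normc (phase z) <= 1.
Proof.
rewrite -lecR -normrc normrM normfV normr_id.
by have [->|z0] := eqVneq z 0; rewrite ?normr0 ?mul0r ?ler01// divff ?normr_eq0.
Qed.

(** A norming functional: for a finite set [F] its norm is at most 1, and its value at an element
    [u] of [l1] is the part over [F] of the norm series of [u]. *)
Definition test (F : seq S) (u : S -> R[i]) : l1 -> C :=
  \sum_(s <- F) (phase (u s) * (w s)%:C) *: coord s.

Lemma test_in F u : P (test F u).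
Proof. exact: c0_functionals_sum. Qed.

Lemma opnorm_test (F : {fset S}) u : opnorm (test F u) <= 1.
Proof.
have [+ _ _ _] := c0_functionals_closed => /(_ _ (test_in F u)) dt.
apply: opnorm_le_delta => // s; rewrite /test coord_sum_delta mul1r.
have ws0 := weight_gt0 w s.
case: ifPn => _; last by rewrite ComplexField.Normc.normc0 ltW.
rewrite ComplexField.Normc.normcM -[leRHS]mul1r ler_pM ?normc_ge0//.
  exact: normc_phase_le.
by rewrite -lecR -normrc gtr0_norm ?ltcR.
Qed.

Lemma test_sum (F : seq S) u :
  \sum_(s <- F) (phase (u s) * (w s)%:C) * u s =
  (\sum_(s <- F) normc (u s) * w s)%:C.
Proof.
by rewrite rmorph_sum; apply: eq_bigr => s _; rewrite mulrAC phaseM -rmorphM.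
Qed.

Lemma l1norm_le (u : S -> R[i]) (M : R) :
  (forall F : {fset S}, \sum_(s <- F) normc (u s) * w s <= M) ->
  (@l1norm R S w u <= M%:E)%E.
Proof.
move=> uM; apply: ge_ereal_sup => _ [X [/finite_fsetP[F ->] _] <-].
by rewrite fsbig_finite//= set_fsetK sumEFin lee_fin.
Qed.

Lemma normc_real (x : R) : 0 <= x -> normc x%:C = x.
Proof. by move=> x0; apply: complexI; rewrite -normrc ger0_norm// lecR. Qed.

Lemma normc_test_sum (F : seq S) u :
  normc (\sum_(s <- F) (phase (u s) * (w s)%:C) * u s) =
  \sum_(s <- F) normc (u s) * w s.
Proof.
rewrite test_sum normc_real// sumr_ge0// => s _.
by rewrite mulr_ge0 ?normc_ge0// ltW// weight_gt0.
Qed.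

(** One inequality comes from the functionals [test F a], whose values at [a] are the partial sums
    of the norm; the other from [normc_dual]. *)
Lemma c0_functionals_isometry a :
  `|a| = (sup [set normc (f a) | f in P `&` [set f | opnorm f <= 1]])%:C.
Proof.
have [Pdual P0 _ _] := c0_functionals_closed.
rewrite normr_l1nrm; congr (_%:C); apply/eqP; rewrite eq_le; apply/andP; split.
  rewrite -lee_fin l1nrmE; apply: l1norm_le => F.
  rewrite -normc_test_sum -coord_sumE; apply: ub_le_sup; last first.
    by exists (test F a) => //; split; [exact: test_in|exact: opnorm_test].
  exists (l1nrm a) => _ [f [/Pdual df /= f1] <-].
  by rewrite (le_trans (normc_dual _ df))// Re_norm_l1 ler_piMl// l1nrm_ge0.
apply: ge_sup.
  exists (normc (test fset0 a a)), (test fset0 a) => //.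
  by split; [exact: test_in|exact: opnorm_test].
move=> _ [f [/Pdual df /= f1] <-].
by rewrite (le_trans (normc_dual _ df))// Re_norm_l1 ler_piMl// l1nrm_ge0.
Qed.

(** The representing element is [s |-> L (coord s)]. Applying [L] to [test F u] bounds all partial
    sums of its norm; the finitely supported truncations [g] of [f] satisfy [L g = g a] and
    approximate [f] in norm. *)
Lemma c0_functionals_surjective (L : (l1 -> C) -> C) :
  bounded_functional_on P L -> exists a, forall f, P f -> L f = f a.
Proof.
move=> bL; have [Llin [M LM]] := bL.
have [Pdual P0 Plin _] := c0_functionals_closed.
pose u s := L (coord s).
(* With [|M|] in place of [M], upper bounds on [opnorm f] can be inserted. *)
have LM' f : P f -> normc (L f) <= `|M| * opnorm f.
  move=> Pf; rewrite (le_trans (LM f Pf))// ler_wpM2r ?ler_norm//.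
  exact/opnorm_ge0/Pdual.
have u_in : u \in @l1_pred R S w.
  rewrite inE/=; apply: (@le_lt_trans _ _ `|M|%:E); last exact: ltry.
  apply: l1norm_le => F; rewrite -normc_test_sum.
  have [_] := bounded_functional_sum F (fun s => phase (u s) * (w s)%:C) bL
    c0_functionals_coord.
  move=> /(congr1 (@normc R)) <-.
  rewrite (le_trans (LM' _ (test_in F u)))// ler_piMr//; exact: opnorm_test.
exists (L1 u_in) => f Pf; set a := L1 u_in.
have /c0_functionalsP[df f0] := Pf.
apply/eqP; rewrite -subr_eq0; apply/eqP/ComplexField.Normc.eq0_normc.
apply/eqP; rewrite eq_le normc_ge0 andbT; apply/ler_addgt0Pr => e e0.
rewrite add0r.
(* [K] covers the two errors [L (f - g)] and [(f - g) a]; the 1 makes it positive. *)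
pose K := `|M| + l1nrm a + 1.
have K0 : 0 < K by rewrite ltr_wpDl// addr_ge0// l1nrm_ge0.
have [X /finite_fsetP[F ->] XK] := f0 _ (divr_gt0 e0 K0).
pose g : l1 -> C := \sum_(s <- F) f (delta w s) *: coord s.
have [Pg Lg] := bounded_functional_sum F (fun s => f (delta w s)) bL
  c0_functionals_coord.
have {}Lg : L g = g a by rewrite Lg /g coord_sumE.
have dg := Pdual _ Pg.
have Pfg : P (-1 *: g + f) by exact: Plin.
have dfg := Pdual _ Pfg.
have fg_le : opnorm (-1 *: g + f) <= e / K.
  apply: opnorm_le_delta => //; first by rewrite ltW// divr_gt0.
  move=> s; rewrite scaleN1r addrC.
  have -> : (f - g) (delta w s) = f (delta w s) - g (delta w s) by [].
  rewrite /g coord_sum_delta.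
  case: ifPn => sF.
    rewrite subrr ComplexField.Normc.normc0 mulr_ge0 ?ltW ?weight_gt0//.
    exact: divr_gt0.
  rewrite subr0 -ler_pdivrMr ?weight_gt0// -normc_divw ltW// XK//=.
  exact/negP.
have -> : L f - f a = L (-1 *: g + f) - (-1 *: g + f) a.
  rewrite Llin// !fctE !scaleN1r Lg opprD opprK addrACA addNr add0r//.
rewrite (le_trans (le_normcD _ _))// normcN.
rewrite (le_trans (lerD (LM' _ Pfg) (normc_dual a dfg)))//.
rewrite Re_norm_l1 mulrC -mulrDr (le_trans (ler_wpM2r _ fg_le))//.
  by rewrite addr_ge0// l1nrm_ge0.
by rewrite mulrAC ler_pdivrMr// ler_wpM2l ?(ltW e0)// lerDl.
Qed.

Lemma c0_functionals_predual : predual P.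
Proof.
split; first exact: c0_functionals_closed.
  exact: c0_functionals_isometry.
exact: c0_functionals_surjective.
Qed.

Lemma convolution_banach : banach_algebra (@convolution R S w).
Proof.
split.
- exact: predual_complete c0_functionals_predual.
- exact: convolutionA.
- exact: convolution_linearr.
- exact: convolution_linearl.
- exact: norm_convolution.
Qed.

End predual_of_l1.

(** * The submodule condition in terms of fibers of translations *)

Section submodule_criterion.
Variables (R : realType) (S : semigroupType) (w : weight R S).
Local Notation C := (R[i]^o).
Local Notation l1 := (@l1 R S w).
Local Notation P := (@c0_functionals R S w).
Local Notation conv := (@convolution R S w).

(** In use [q] is a translation by [t] and [K] is [w t]. If [f (delta (q r)) / w r] has modulus at
    least [e], then [w (q r) <= w r * K] puts [q r] in a finite set [F], while [1 / w r] is at least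
    [e / N (q r)]; so [r] lies in one of finitely many finite sets [G s]. *)
Lemma c0_translate (q : S -> S) (K : R) (f : l1 -> C) :
  (forall r, w (q r) <= w r * K) -> 0 < K ->
  (forall s, @c0 R S (fun r => \1_[set r | q r = s] r / (w r)%:C)) -> P f ->
  c0 (fun r => f (delta w (q r)) / (w r)%:C).
Proof.
move=> wq K0 fib0 /c0_functionalsP[df f0]; apply/c0P => e e0.
have [F finF Fe] := f0 _ (divr_gt0 e0 K0).
pose N s := normc (f (delta w s)) + 1.
have N0 s : 0 < N s by rewrite ltr_wpDl ?normc_ge0.
pose G s := [set r |
  e / N s <= normc (\1_[set r | q r = s] r / (w r)%:C : R[i])].
apply: (@sub_finite_set _ _ (\bigcup_(s in F) G s)); last first.
  apply: bigcup_finite => // s _.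
  by have /c0P := fib0 s; apply; rewrite divr_gt0.
move=> r /=; rewrite normc_divw => er.
have Fqr : F (q r).
  apply: contrapT => /Fe; rewrite normc_divw; apply/negP; rewrite -leNgt.
  rewrite ler_pdivrMr// mulrAC ler_pdivlMr ?weight_gt0//.
  rewrite ler_pdivlMr ?weight_gt0// in er.
  apply: le_trans (ler_wpM2l (ltW e0) (wq r)) _.
  by rewrite mulrA ler_wpM2r// ltW.
exists (q r) => //; rewrite /G /mkset normc_divw.
have -> : \1_[set r' | q r' = q r] r = 1 :> R[i] by rewrite indicE mem_set.
rewrite ComplexField.Normc.normc1.
rewrite ler_pdivrMr// (le_trans er)// mulrAC.
rewrite ler_wpM2r ?invr_ge0 ?(ltW (weight_gt0 _ _))//.
by rewrite mul1r lerDl.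
Qed.

(** In use [m r a] is the product of [delta r] and [a] in one of the two orders. After division by
    [w r] the bound on [m r] is uniform in [r], so approximating [a] by finite combinations of point
    masses gives the uniform approximation that [c0_approx] needs. *)
Lemma c0_module (m : S -> l1 -> l1) (f : l1 -> C) :
  (forall r, clinear (m r)) ->
  (forall r a, l1nrm (m r a) <= w r * l1nrm a) -> dual f ->
  (forall s, c0 (fun r => f (m r (delta w s)) / (w r)%:C)) ->
  forall a, c0 (fun r => f (m r a) / (w r)%:C).
Proof.
move=> cm mle df f0 a; apply: c0_approx => e e0.
have K0 : 0 < opnorm f + 1 by rewrite ltr_wpDl// opnorm_ge0.
have [F Fe] := l1_approx a (divr_gt0 e0 K0).
set u := \sum_(s <- F) _ in Fe.
exists (fun r => f (m r u) / (w r)%:C).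
  have := c0_sum F (fun s => a s) f0; congr c0; apply/funext => r.
  rewrite (clinear_sum _ _ _ (cm r)) (clinear_sum _ _ _ df) mulr_suml.
  by apply: eq_bigr => s _; rewrite mulrA.
move=> r; rewrite -mulrBl -(clinearB _ _ df) -(clinearB _ _ (cm r)) normc_divw.
rewrite ler_pdivrMr ?weight_gt0// (le_trans (normc_dual _ df))// Re_norm_l1.
apply: (le_trans (ler_wpM2l (opnorm_ge0 df) (mle r (a - u)))).
rewrite mulrCA mulrC ler_wpM2r ?(ltW (weight_gt0 _ _))//.
apply: (@le_trans _ _ ((opnorm f + 1) * l1nrm (a - u))).
  by rewrite ler_wpM2r ?l1nrm_ge0// lerDl.
by rewrite mulrC -ler_pdivlMr.
Qed.

Lemma lact_c0_functionals :
  (forall s t, @c0 R S (fun r => \1_(rquot s t) r / (w r)%:C)) <->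
  (forall a f, P f -> P (lact conv a f)).
Proof.
split=> [fib0 a f Pf|Pact s t].
  have /c0_functionalsP[df _] := Pf; apply/c0_functionalsP; split.
    exact: clinear_comp (clinear_convl a) df.
  apply: (c0_module (m := fun r a => conv (delta w r) a)) => //.
  - by move=> r; exact: clinear_convr.
  - by move=> r b; rewrite (le_trans (l1nrm_convolution _ _))// l1nrm_delta.
  move=> t; under eq_fun do rewrite convolution_delta.
  apply: (@c0_translate _ (w t)) => //.
  - by move=> r; exact: weight_submul.
  - exact: weight_gt0.
  - by move=> s; exact: fib0.
(* The value of [lact conv (delta t) (coord s)] at [delta r] is 1 if [r * t = s] and 0 otherwise,
   which is the indicator of [rquot s t]. *)
have /c0_functionalsP[_] := Pact (delta w t) _ (c0_functionals_coord w s).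
congr c0; apply/funext => r; rewrite /lact convolution_delta; congr (_ / _).
rewrite /coord/= /point indicE; congr (nat_of_bool _)%:R.
by apply/eqP/idP => [->|/set_mem//]; rewrite mem_set.
Qed.

(** The mirror image of [lact_c0_functionals], with the left translation [r |-> t * r] in place of
    the right one. *)
Lemma ract_c0_functionals :
  (forall s t, @c0 R S (fun r => \1_(lquot t s) r / (w r)%:C)) <->
  (forall a f, P f -> P (ract conv f a)).
Proof.
split=> [fib0 a f Pf|Pact s t].
  have /c0_functionalsP[df _] := Pf; apply/c0_functionalsP; split.
    exact: clinear_comp (clinear_convr a) df.
  apply: (c0_module (m := fun r a => conv a (delta w r))) => //.
  - by move=> r; exact: clinear_convl.
  - move=> r b; rewrite (le_trans (l1nrm_convolution _ _))// l1nrm_delta.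
    by rewrite mulrC.
  move=> t; under eq_fun do rewrite convolution_delta.
  apply: (@c0_translate _ (w t)) => //.
  - by move=> r; rewrite mulrC; exact: weight_submul.
  - exact: weight_gt0.
  - by move=> s; exact: fib0.
have /c0_functionalsP[_] := Pact (delta w t) _ (c0_functionals_coord w s).
congr c0; apply/funext => r; rewrite /ract convolution_delta; congr (_ / _).
rewrite /coord/= /point indicE; congr (nat_of_bool _)%:R.
by apply/eqP/idP => [->|/set_mem//]; rewrite mem_set.
Qed.

End submodule_criterion.

Theorem theorem2p2 (R : realType) (S : semigroupType) (w : weight R S) :
  (left_dual_banach_algebra (@convolution R S w) (@c0_functionals R S w) <->
    forall s t : S, @c0 R S (fun r => \1_(rquot s t) r / (w r)%:C)) /\
  (right_dual_banach_algebra (@convolution R S w) (@c0_functionals R S w) <->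
    forall s t : S, @c0 R S (fun r => \1_(lquot t s) r / (w r)%:C)).
Proof.
(* The Banach algebra and predual conditions hold for every weight, which leaves only the submodule
   conditions to compare. *)
have bA := convolution_banach w; have pP := c0_functionals_predual w.
split; split=> [[_ _]|fib0].
- by move/lact_c0_functionals.
- by split=> //; exact/lact_c0_functionals.
- by move/ract_c0_functionals.
- by split=> //; exact/ract_c0_functionals.
Qed.
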